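(* Let $n\ge 2$ and let $A$ be a set of $2^n-1$ distinct, pairwise commuting, non-identity $n$-qubit Pauli operators. Let $\{|e_i\rangle\}_{i=1}^{2^n}$ be an orthonormal basis of $(\mathbb{C}^2)^{\otimes n}$ of common eigenvectors of the elements of $A$. Let $H$ be a (total) Hamiltonian on $(\mathbb{C}^2)^{\otimes n}\otimes\mathcal{H}_B$, with $\mathcal{H}_B$ a finite-dimensional bath Hilbert space, such that $[H,O\otimes I]=0$ for every $O\in A$, and let $\rho^B$ be a density operator on $\mathcal{H}_B$. For a density matrix $\rho(0)$ of the $n$ qubits let $\rho(t)=\mathrm{Tr}_B\big[e^{-iHt}(\rho(0)\otimes\rho^B)e^{iHt}\big]$, and let $r_{ij}(t)$ be the functions (independent of $\rho(0)$) such that $\rho_{ij}(t)=r_{ij}(t)\rho_{ij}(0)$ for all $i,j$ and all $\rho(0)$, where $\rho_{ij}=\langle e_i|\rho|e_j\rangle$. Suppose there exist a probability density $p$ on $\mathbb{R}$ and functions $\theta_i(t)=\int_0^t d_i(t')\,dt'$, $1\le i\le 2^n$, with $d_i$ real-valued and locally integrable on $[0,\infty)$, such that $$r_{ij}(t)=\tilde p\big(\gamma_{ij}(t)\big),\qquad \gamma_{ij}(t)=\theta_i(t)-\theta_j(t),\qquad \tilde p(x)=\int_{-\infty}^{\infty}p(\alpha)e^{-i\alpha x}\,d\alpha$$ for all $i,j$ and all $t\ge0$ (with the $i$ in $e^{-i\alpha x}$ the imaginary unit). Then the quantum dynamics can be simulated classically: there are Hermitian noise Hamiltonians $H_\alpha(t)=\alpha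 D(t)$, $\alpha\in\mathbb{R}$, where $D(t)$ is a real linear combination of the operators in $A$, such that, with $U_\alpha(t)=\exp\big(-i\int_0^tH_\alpha(t')\,dt'\big)$, $$\rho(t)=\int_{-\infty}^{\infty}p(\alpha)\,U_\alpha(t)\,\rho(0)\,U_\alpha(t)^\dagger\,d\alpha$$ for every initial density matrix $\rho(0)$ of the $n$ qubits and every $t\ge 0$.
   Context: An $n$-qubit Pauli operator is a tensor product $\sigma_{i_1}\otimes\cdots\otimes\sigma_{i_n}$ with each $\sigma_{i_k}\in\{\sigma_0=I,\sigma_x,\sigma_y,\sigma_z\}$; there are $4^n$ of them including the identity. Together with the identity, the elements of $A$ form $2^n$ linearly independent commuting operators, spanning the operators diagonal in the basis $\{|e_i\rangle\}$. For example, for $n=2$, $A=\{\sigma_x\otimes\sigma_x,\sigma_y\otimes\sigma_y,\sigma_z\otimes\sigma_z\}$ with $\{|e_i\rangle\}$ the Bell basis. $\mathrm{Tr}_B$ is the partial trace over the bath, $\hbar=1$, and the system and bath are initially in a product state. *)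

(* Defs.v *)
From HB Require Import structures.
From mathcomp Require Import all_boot all_order all_algebra.
From mathcomp Require Import complex mxtens.
From mathcomp Require Import all_classical all_reals all_analysis.
Import Order.TTheory GRing.Theory Num.Theory numFieldNormedType.Exports.

Set Implicit Arguments.
Unset Strict Implicit.
Unset Printing Implicit Defensive.

Local Open Scope classical_set_scope.
Local Open Scope ring_scope.
Local Open Scope complex_scope.
Local Open Scope sesquilinear_scope.

Section Pauli.
Variable R : realType.
Local Notation C := R[i].

Definition mx2 (a b c d : C) : 'M[C]_2 :=
  \matrix_(i, j) if i == 0 then (if j == 0 then a else b)
                 else (if j == 0 then c else d).

Definition sigma_0 : 'M[C]_2 := 1%:M.
Definition sigma_x : 'M[C]_2 := mx2 0 1 1 0.
Definition sigma_y : 'M[C]_2 := mx2 0 (- 'i%C) 'i%C 0.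
Definition sigma_z : 'M[C]_2 := mx2 1 0 0 (- 1).

(* F 0 *t F 1 *t ... ; the base case is a single factor because
   2 ^ k.+2 reduces to 2 * 2 ^ k.+1 whereas 2 ^ k.+1 does not reduce
   to 2 * 2 ^ k for a variable k. *)
Fixpoint tensor_rec (k : nat) : ('I_k.+1 -> 'M[C]_2) -> 'M[C]_(2 ^ k.+1) :=
  match k return ('I_k.+1 -> 'M[C]_2) -> 'M[C]_(2 ^ k.+1) with
  | 0 => fun F => F ord0
  | k'.+1 => fun F => F ord0 *t tensor_rec (fun i => F (lift ord0 i))
  end.

Definition tensor (n : nat) : ('I_n -> 'M[C]_2) -> 'M[C]_(2 ^ n) :=
  match n return ('I_n -> 'M[C]_2) -> 'M[C]_(2 ^ n) with
  | 0 => fun=> 1%:M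
  | k.+1 => @tensor_rec k
  end.

Definition pauli_operator (n : nat) (O : 'M[C]_(2 ^ n)) : Prop :=
  exists2 F : 'I_n -> 'M[C]_2,
    forall k, F k \in [:: sigma_0; sigma_x; sigma_y; sigma_z]
    & O = tensor F.

End Pauli.

Section Operators.
Variable R : realType.
Local Notation C := R[i].

(* <u | M | v> *)
Definition mxelt (n : nat) (u : 'cV[C]_n) (M : 'M[C]_n) (v : 'cV[C]_n) : C :=
  (u ^t* *m M *m v) 0 0.

(* n orthonormal vectors of C^n automatically span it. *)
Definition orthonormal_basis (n : nat) (e : 'I_n -> 'cV[C]_n) : Prop :=
  forall i j, ((e i) ^t* *m e j) 0 0 = (i == j)%:R.

Definition eigenvector (n : nat) (O : 'M[C]_n) (v : 'cV[C]_n) : Prop :=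
  v != 0 /\ exists l : C, O *m v = l *: v.

(* On R[i], 0 <= z means that z is a nonnegative real. *)
Definition density_operator (n : nat) (rho : 'M[C]_n) : Prop :=
  [/\ rho \is hermsymmx, forall v : 'cV[C]_n, 0 <= mxelt v rho v
    & \tr rho = 1].

Definition expmx (n : nat) (M : 'M[C]_n) : 'M[C]_n :=
  limn (series (fun k => k`!%:R^-1 *: M ^+ k) : nat -> 'M[C^o]_n).

(* Trace over the second factor, in the indexing of M *t N. *)
Definition partial_trace (n m : nat) (M : 'M[C]_(n * m)) : 'M[C]_n :=
  \matrix_(i, j) \sum_(k < m) M (mxtens_index (i, k)) (mxtens_index (j, k)).

Definition reduced_state (n m : nat) (H : 'M[C]_(n * m)) (rhoB : 'M[C]_m)
    (rho0 : 'M[C]_n) (t : R) : 'M[C]_n :=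
  partial_trace (expmx ((- 'i%C * t%:C) *: H) *m (rho0 *t rhoB)
                 *m expmx (('i%C * t%:C) *: H)).

End Operators.

Section Integrals.
Variable R : realType.
Local Notation C := R[i].
Local Notation mu := (@lebesgue_measure R).

Definition cintegrable (D : set R) (f : R -> C) : Prop :=
  mu.-integrable D (fun x => (complex.Re (f x))%:E) /\
  mu.-integrable D (fun x => (complex.Im (f x))%:E).

Definition cintegral (D : set R) (f : R -> C) : C :=
  (\int[mu]_(x in D) complex.Re (f x)) +i* (\int[mu]_(x in D) complex.Im (f x)).

Definition mxintegrable (n : nat) (D : set R) (F : R -> 'M[C]_n) : Prop :=
  forall i j, cintegrable D (fun x => F x i j).

Definition mxintegral (n : nat) (D : set R) (F : R -> 'M[C]_n) : 'M[C]_n :=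
  \matrix_(i, j) cintegral D (fun x => F x i j).

Definition probability_density (p : R -> R) : Prop :=
  [/\ measurable_fun setT p, forall x, 0 <= p x
    & (\int[mu]_x (p x)%:E = 1)%E].

Definition locally_integrable_nonneg (f : R -> R) : Prop :=
  forall T : R, 0 <= T -> mu.-integrable `[0, T] (fun x => (f x)%:E).

(* e^{i x} for real x *)
Definition expi (x : R) : C := cos x +i* sin x.

Definition fourier (p : R -> R) (x : R) : C :=
  cintegral setT (fun a => (p a)%:C * expi (- (a * x))).

(* exp(-i \int_0^t H(s) ds), not a time-ordered exponential *)
Definition propagator (n : nat) (H : R -> 'M[C]_n) (t : R) : 'M[C]_n :=
  expmx (- 'i%C *: mxintegral `[0, t] H).

End Integrals.

(* Main.v *)
Require Import Defs.
From HB Require Import structures.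
From mathcomp Require Import all_boot all_order all_algebra.
From mathcomp Require Import complex mxtens.
From mathcomp Require Import all_classical all_reals all_analysis.
From mathcomp Require Import measurable_realfun ring.
Import Order.TTheory GRing.Theory Num.Theory numFieldNormedType.Exports.

(** The noise Hamiltonian is the traceless part of [\sum_i d_i(t) |e_i><e_i|],
    multiplied by [alpha].  The spectral projectors of the basis are real
    combinations of [1 :: A]: the eigenvalue matrix of these [2 ^ n] commuting
    Pauli operators has orthogonal rows (distinct Pauli operators are
    trace-orthogonal), hence orthogonal columns.  Dropping the identity
    component shifts all the [d_i] by the same amount, which only changes a
    global phase.  The propagator is then diagonal with entries
    [e^{- i alpha phase_j(t)}], where [phase_i - phase_j = theta_i - theta_j],
    so conjugation multiplies [rho_ij] by [e^{- i alpha gamma_ij(t)}]; averaging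
    over [alpha] gives the factor [\tilde p (gamma_ij(t)) = r_ij(t)]. *)

Set Implicit Arguments.
Unset Strict Implicit.
Unset Printing Implicit Defensive.

Local Open Scope classical_set_scope.
Local Open Scope ring_scope.
Local Open Scope complex_scope.
Local Open Scope sesquilinear_scope.

(** * Traces and identities of Kronecker products *)

Lemma mxtrace_tens (R : comPzRingType) (m n : nat) (A : 'M[R]_m) (B : 'M[R]_n) :
  \tr (A *t B) = \tr A * \tr B.
Proof. by rewrite /mxtrace mulr_sum; apply: eq_bigr => i _; rewrite mxE. Qed.

Lemma tensmx11 (R : comPzRingType) (m n : nat) :
  (1%:M : 'M[R]_m) *t (1%:M : 'M[R]_n) = 1%:M.
Proof.
apply/matrixP => i j.
case: (mxtens_indexP i) => i0 i1; case: (mxtens_indexP j) => j0 j1.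
rewrite tensmxE !mxE -natrM mulnb (inj_eq (can_inj (@mxtens_indexK m n))).
by rewrite xpair_eqE.
Qed.

(** * Pauli operators: Hermiticity and trace orthogonality *)

Section PauliOrthogonality.
Variable R : realType.
Local Notation C := R[i].
Local Notation paulis := [:: sigma_0 R; sigma_x R; sigma_y R; sigma_z R].

Lemma tensor_recM (k : nat) (F G : 'I_k.+1 -> 'M[C]_2) :
  tensor_rec F *m tensor_rec G = tensor_rec (fun i => F i *m G i).
Proof.
elim: k F G => [|k IHk] F G //=.
(* The dimensions [2 ^ k.+2] and [2 * 2 ^ k.+1] agree only up to conversion, so the facts about [*t]
   are chained as terms. *)
exact: etrans (tensmx_mul _ _ _ _) (congr1 _ (IHk _ _)).
Qed.

Lemma mxtrace_tensor_rec (k : nat) (F : 'I_k.+1 -> 'M[C]_2) :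
  \tr (tensor_rec F) = \prod_i \tr (F i).
Proof.
elim: k F => [|k IHk] F /=; first by rewrite big_ord_recl big_ord0 mulr1.
rewrite big_ord_recl -IHk; exact: mxtrace_tens.
Qed.

Lemma tensor_rec_adj (k : nat) (F : 'I_k.+1 -> 'M[C]_2) :
  (tensor_rec F) ^t* = tensor_rec (fun i => (F i) ^t*).
Proof.
elim: k F => [|k IHk] F //=.
rewrite -IHk; exact: etrans (congr1 _ (trmx_tens _ _)) (map_mxT _ _ _).
Qed.

Lemma tensor_rec1 (k : nat) : tensor_rec (fun _ : 'I_k.+1 => sigma_0 R) = 1%:M.
Proof. by elim: k => [|k IHk] //=; rewrite IHk; apply: tensmx11. Qed.

(** Gives the identity the shape of the other three matrices, so that one computation with [mx2]
    covers all cases. *)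
Lemma sigma_0E : sigma_0 R = mx2 1 0 0 1.
Proof. by apply/matrixP => -[[|[|//]] ?] [[|[|//]] ?]; rewrite !mxE. Qed.

Lemma mx2_adj (a b c d : C) :
  (mx2 a b c d) ^t* = mx2 (conjc a) (conjc c) (conjc b) (conjc d).
Proof. by apply/matrixP => -[[|[|//]] ?] [[|[|//]] ?]; rewrite !mxE. Qed.

Lemma mxtrace_mx2M (a b c d a' b' c' d' : C) :
  \tr (mx2 a b c d *m mx2 a' b' c' d') = a * a' + b * c' + c * b' + d * d'.
Proof.
rewrite /mxtrace !big_ord_recl big_ord0 !mxE !big_ord_recl !big_ord0 !mxE /=.
by rewrite !addr0 addrA.
Qed.

Lemma sigma_adj (s : 'M[C]_2) : s \in paulis -> s ^t* = s.
Proof.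
rewrite !inE => /or4P[] /eqP ->;
  rewrite ?sigma_0E ?/sigma_x ?/sigma_y ?/sigma_z mx2_adj; congr mx2;
  by apply/eqP; rewrite eq_complex /= ?oppr0 ?opprK !eqxx.
Qed.

Lemma mxtrace_sigmaM (s s' : 'M[C]_2) : s \in paulis -> s' \in paulis ->
  \tr (s *m s') = if s == s' then 2 else 0.
Proof.
have -> : 2 = (1 + 1) +i* 0 :> C by rewrite -[2]/(1 +i* 0 + 1 +i* 0); simpc.
case: eqP => [<-|].
  by rewrite !inE => /or4P[] /eqP -> _; rewrite ?sigma_0E mxtrace_mx2M; simpc.
move=> neq; rewrite !inE => /or4P[] /eqP sE /or4P[] /eqP s'E;
  rewrite {}sE {}s'E in neq *;
  by [case: neq | rewrite ?sigma_0E mxtrace_mx2M; simpc; rewrite ?addrN ?addNr].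
Qed.

Lemma pauli_operator1 (n : nat) : pauli_operator (1%:M : 'M[C]_(2 ^ n)).
Proof.
exists (fun=> sigma_0 R) => [k|]; first by rewrite inE eqxx.
by case: n => [|n] //=; rewrite tensor_rec1.
Qed.

Lemma pauli_operator_adj (n : nat) (O : 'M[C]_(2 ^ n)) :
  pauli_operator O -> O ^t* = O.
Proof.
case=> F F_pauli ->{O}; case: n F F_pauli => [|n] F F_pauli /=.
  by rewrite trmx1 map_mx1.
rewrite tensor_rec_adj; congr tensor_rec; apply/funext => i.
by rewrite sigma_adj.
Qed.

(** The trace factors over the qubits. Equal operators give a factor 2 on each qubit; for different
    ones some qubit carries two different sigma matrices, whose product is traceless. *)
Lemma mxtrace_pauliM (n : nat) (O O' : 'M[C]_(2 ^ n)) :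
  pauli_operator O -> pauli_operator O' ->
  \tr (O *m O') = if O == O' then (2 ^ n)%:R else 0.
Proof.
case=> F F_pauli ->{O} [G G_pauli ->{O'}].
case: n F G F_pauli G_pauli => [|n] F G FP GP.
  by rewrite /= eqxx mulmx1 mxtrace1.
rewrite /= tensor_recM mxtrace_tensor_rec.
case: eqP => [FG|/eqP FG].
  (* Equality of the tensor products does not directly give [F = G]; instead the second operator is
     replaced by the first inside the whole trace. *)
  have : \prod_i \tr (F i *m F i) = \prod_i \tr (F i *m G i).
    by rewrite -!mxtrace_tensor_rec -!tensor_recM FG.
  move=> <-; under eq_bigr do rewrite mxtrace_sigmaM // eqxx.
  by rewrite prodr_const card_ord natrX.
have [i FGi] : exists i, F i != G i.
  apply/existsP; rewrite -negb_forall; apply: contraNN FG => /forallP FG.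
  by apply/eqP; congr tensor_rec; apply/funext => i; apply/eqP.
by rewrite (bigD1 i) //= mxtrace_sigmaM // (negPf FGi) mul0r.
Qed.

End PauliOrthogonality.

(** * Operators diagonal in an orthonormal basis *)

Section OrthonormalBasis.
Variables (R : realType) (n : nat) (e : 'I_n -> 'cV[R[i]]_n).
Local Notation C := R[i].

Definition basis_mx : 'M[C]_n := \matrix_(k, i) e i k 0.

Lemma mxelt_basis_mx (M : 'M[C]_n) :
  basis_mx ^t* *m M *m basis_mx = \matrix_(i, j) mxelt (e i) M (e j).
Proof.
apply/matrixP => i j; rewrite /mxelt !mxE; apply: eq_bigr => k _; rewrite !mxE.
by congr (_ * _); apply: eq_bigr => l _; rewrite !mxE.
Qed.

Hypothesis e_basis : orthonormal_basis e.

Lemma basis_mx_unitary : basis_mx ^t* *m basis_mx = 1%:M.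
Proof.
rewrite -[_ ^t*]mulmx1 mxelt_basis_mx; apply/matrixP => i j.
by rewrite !mxE /mxelt mulmx1 e_basis.
Qed.

Lemma basis_mx_unitaryC : basis_mx *m basis_mx ^t* = 1%:M.
Proof. exact: mulmx1C basis_mx_unitary. Qed.

(** With [B] the unitary basis matrix, [M = B (B^* M B) B^*], and the inner factor is the array of
    matrix elements. *)
Lemma mxelt_inj (M N : 'M[C]_n) :
  (forall i j, mxelt (e i) M (e j) = mxelt (e i) N (e j)) -> M = N.
Proof.
move=> eqMN; rewrite -[M]mul1mx -[N]mul1mx -basis_mx_unitaryC.
rewrite -[M]mulmx1 -[N]mulmx1 -basis_mx_unitaryC !mulmxA; congr (_ *m _).
rewrite -!mulmxA; congr (_ *m _); rewrite !mulmxA !mxelt_basis_mx.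
by apply/matrixP => i j; rewrite !mxE.
Qed.

(** The operator [\sum_i x i |e_i><e_i|]. The values are complex so that Hamiltonians and
    propagators both have this form. *)
Definition diag_in_basis (x : 'I_n -> C) : 'M[C]_n :=
  basis_mx *m diag_mx (\row_i x i) *m basis_mx ^t*.

(** Each entry is a fixed linear form in [x]; this is how sums, limits and integrals pass from
    operators to eigenvalues. *)
Lemma diag_in_basisE (x : 'I_n -> C) (k l : 'I_n) :
  diag_in_basis x k l = \sum_i x i * (e i k 0 * (e i l 0)^*).
Proof.
rewrite !mxE; apply: eq_bigr => i _; rewrite !mxE (bigD1 i) //= !mxE eqxx.
rewrite big1 ?addr0 => [|j /negPf ji]; last by rewrite !mxE ji mulr0.
by rewrite mulr1n mulrA [_ * e i k 0]mulrC.
Qed.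

Lemma diag_in_basisM (x y : 'I_n -> C) :
  diag_in_basis x *m diag_in_basis y = diag_in_basis (fun i => x i * y i).
Proof.
rewrite /diag_in_basis -!mulmxA [X in _ *m (_ *m X)]mulmxA basis_mx_unitary.
rewrite mul1mx !mulmxA; congr (_ *m _); rewrite -!mulmxA; congr (_ *m _).
by rewrite mulmx_diag; congr diag_mx; apply/rowP => i; rewrite !mxE.
Qed.

Lemma diag_in_basisZ (a : C) (x : 'I_n -> C) :
  a *: diag_in_basis x = diag_in_basis (fun i => a * x i).
Proof.
apply/matrixP => k l; rewrite mxE !diag_in_basisE mulr_sumr.
by apply: eq_bigr => i _; rewrite mulrA.
Qed.

Lemma diag_in_basis_sum (I : Type) (s : seq I) (x : I -> 'I_n -> C) :
  \sum_(j <- s) diag_in_basis (x j) = diag_in_basis (fun i => \sum_(j <- s) x j i).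
Proof.
apply/matrixP => k l; rewrite summxE diag_in_basisE.
under eq_bigr do rewrite diag_in_basisE.
by rewrite exchange_big; apply: eq_bigr => i _; rewrite mulr_suml.
Qed.

Lemma diag_in_basis1 : diag_in_basis (fun=> 1) = 1%:M.
Proof.
rewrite /diag_in_basis (_ : diag_mx _ = 1%:M) ?mulmx1 ?basis_mx_unitaryC //.
by apply/matrixP => i j; rewrite !mxE.
Qed.

Lemma diag_in_basisX (x : 'I_n -> C) (k : nat) :
  diag_in_basis x ^+ k = diag_in_basis (fun i => x i ^+ k).
Proof.
elim: k => [|k IHk]; first by rewrite expr0 -[LHS]diag_in_basis1.
rewrite exprS IHk; apply: etrans (diag_in_basisM _ _) _.
by congr diag_in_basis; apply/funext => i; rewrite exprS.
Qed.

Lemma diag_in_basis_adj (x : 'I_n -> C) :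
  (diag_in_basis x) ^t* = diag_in_basis (fun i => (x i)^*).
Proof.
apply/matrixP => k l; rewrite 2!mxE !diag_in_basisE rmorph_sum /=.
apply: eq_bigr => i _; rewrite !rmorphM /= conjCK; congr (_ * _).
exact: mulrC.
Qed.

Lemma mxtrace_diag_in_basis (x : 'I_n -> C) : \tr (diag_in_basis x) = \sum_i x i.
Proof.
rewrite mxtrace_mulC mulmxA basis_mx_unitary mul1mx mxtrace_diag.
by apply: eq_bigr => i _; rewrite mxE.
Qed.

Lemma mxelt_diag_in_basis (x y : 'I_n -> C) (M : 'M[C]_n) (i j : 'I_n) :
  mxelt (e i) (diag_in_basis x *m M *m diag_in_basis y) (e j)
  = x i * y j * mxelt (e i) M (e j).
Proof.
have eltE N : mxelt (e i) N (e j) = (basis_mx ^t* *m N *m basis_mx) i j.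
  by rewrite mxelt_basis_mx mxE.
rewrite !eltE /diag_in_basis !mulmxA basis_mx_unitary mul1mx.
rewrite -[LHS]/((_ *m basis_mx) i j) -(mulmxA _ _ basis_mx) basis_mx_unitary.
rewrite mulmx1.
rewrite -2!(mulmxA (diag_mx _)); move: (_ *m M *m _) => K.
by rewrite mul_mx_diag mul_diag_mx !mxE mulrAC.
Qed.

Lemma mxelt_diag_in_basis1 (x : 'I_n -> C) (i j : 'I_n) :
  mxelt (e i) (diag_in_basis x) (e j) = x i * (i == j)%:R.
Proof.
rewrite -[diag_in_basis x]mulmx1 -[X in _ *m X]diag_in_basis1.
rewrite -[diag_in_basis x]mulmx1 mxelt_diag_in_basis mulr1.
by rewrite /mxelt mulmx1 e_basis.
Qed.

(** Off-diagonal elements vanish, since [O] maps [e j] to a multiple of itself, which is orthogonal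
    to every other [e i]. *)
Lemma eigenvector_diag_in_basis (O : 'M[C]_n) :
  (forall i, eigenvector O (e i)) ->
  O = diag_in_basis (fun i => mxelt (e i) O (e i)).
Proof.
move=> O_eigen; apply: mxelt_inj => i j.
rewrite mxelt_diag_in_basis1.
case: (eqVneq i j) => [->|ij]; first by rewrite mulr1.
have [_ [l Oj]] := O_eigen j.
by rewrite /mxelt -mulmxA Oj -scalemxAr mxE e_basis (negPf ij) !mulr0.
Qed.

End OrthonormalBasis.

(** * Joint eigenvalues of the commuting Pauli operators *)

Lemma pauli_spectrum (R : realType) (n : nat)
    (A : seq 'M[R[i]]_(2 ^ n)) (e : 'I_(2 ^ n) -> 'cV[R[i]]_(2 ^ n)) :
    uniq A -> size A = (2 ^ n - 1)%N ->
    (forall O, O \in A -> pauli_operator O) -> 1%:M \notin A ->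
    orthonormal_basis e -> (forall O i, O \in A -> eigenvector O (e i)) ->
  exists lam : 'M[R[i]]_(2 ^ n) -> 'I_(2 ^ n) -> R,
    (forall O, O \in A -> O = diag_in_basis e (fun i => (lam O i)%:C)) /\
    (forall i j, \sum_(O <- A) lam O i * lam O j = (2 ^ n)%:R * (i == j)%:R - 1).
Proof.
move=> A_uniq A_size A_pauli A_nonid e_basis e_eigen.
(* Taking the real part makes the eigenvalues real by type; Hermiticity shows below that nothing is
   lost. *)
pose lam (O : 'M[R[i]]_(2 ^ n)) i := complex.Re (mxelt (e i) O (e i)).
have oneE : 1%:M = diag_in_basis e (fun i => (lam 1%:M i)%:C).
  rewrite -[LHS](diag_in_basis1 e_basis); congr diag_in_basis; apply/funext => i.
  by rewrite /lam /mxelt mulmx1 e_basis eqxx.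
have AE O : O \in A -> O = diag_in_basis e (fun i => (lam O i)%:C).
  move=> OA.
  have OE : O = diag_in_basis e (fun i => mxelt (e i) O (e i)).
    by apply: eigenvector_diag_in_basis => // i; apply: e_eigen.
  rewrite [LHS]OE; congr diag_in_basis; apply/funext => i; rewrite RRe_real //.
  (* [O] is its own adjoint, and taking the adjoint conjugates the diagonal elements, so these are
     real. *)
  apply/CrealP; rewrite -[RHS](congr1 (fun M => mxelt (e i) M (e i))
    (pauli_operator_adj (A_pauli _ OA))).
  by rewrite [in RHS]OE diag_in_basis_adj mxelt_diag_in_basis1 // eqxx mulr1.
exists lam; split=> // i j.
pose S := 1%:M :: A.
have S_uniq : uniq S by rewrite /= A_nonid.
have S_size : size S = (2 ^ n)%N by rewrite /= A_size subn1 prednK // expn_gt0.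
have SE O : O \in S -> O = diag_in_basis e (fun i => (lam O i)%:C).
  by rewrite inE => /predU1P[->|/AE].
have S_pauli O : O \in S -> pauli_operator O.
  rewrite inE => /predU1P[->|/A_pauli//]; exact: pauli_operator1.
(* Adding the identity to [A] gives exactly [2 ^ n] operators, which makes the eigenvalue matrix
   square. *)
pose L : 'M[R]_(2 ^ n) := \matrix_(a, i) lam (nth 0 S a) i.
have LLt : L *m L^T = (2 ^ n)%:R%:M.
  apply/matrixP => a b; rewrite !mxE; apply: complexI.
  have [Sa Sb] : nth 0 S a \in S /\ nth 0 S b \in S by rewrite !mem_nth ?S_size.
  have := mxtrace_pauliM (S_pauli _ Sa) (S_pauli _ Sb).
  rewrite {1}(SE _ Sa) {1}(SE _ Sb) diag_in_basisM // mxtrace_diag_in_basis //.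
  rewrite nth_uniq ?S_size // (inj_eq val_inj) => trE.
  rewrite rmorph_sum /= (eq_bigr
    (fun k => (lam (nth 0 S a) k)%:C * (lam (nth 0 S b) k)%:C)).
    rewrite trE; case: eqP => _; rewrite ?mulr1n ?mulr0n ?rmorph_nat //.
  by move=> k _; rewrite !mxE rmorphM.
have n0 : (2 ^ n)%:R != 0 :> R by rewrite pnatr_eq0 expn_eq0.
(* For a square matrix a right inverse is a left inverse: [L^T / 2 ^ n] turns orthogonality of rows
   into orthogonality of columns. *)
have /matrixP/(_ i j) : L^T *m L = (2 ^ n)%:R%:M.
  have /mulmx1C : L *m ((2 ^ n)%:R^-1 *: L^T) = 1%:M.
    by rewrite -scalemxAr LLt scale_scalar_mx mulVf.
  rewrite -scalemxAl => /(congr1 (fun M => (2 ^ n)%:R *: M)).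
  by rewrite scalerA divff // scale1r scalemx1.
rewrite !mxE => sumE.
(* All eigenvalues of the identity are 1, so it accounts for exactly 1 in the sum over [S]. *)
have -> : \sum_(O <- A) lam O i * lam O j = \sum_(O <- S) lam O i * lam O j - 1.
  by rewrite big_cons /lam /mxelt !mulmx1 !e_basis !eqxx /= mul1r addrC addKr.
congr (_ - _); rewrite mulr_natr -sumE (big_nth 0) big_mkord S_size.
by apply: eq_bigr => a _; rewrite !mxE.
Qed.

(** * Limits of matrices and the exponential of a diagonal operator *)

Lemma cvg_mx (K : numFieldType) (m n : nat) (T : Type) (F : set_system T)
    (FF : Filter F) (f : T -> 'M[K]_(m, n)) (M : 'M[K]_(m, n)) :
  (forall i j, f x i j @[x --> F] --> M i j) -> f x @[x --> F] --> M.
Proof.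
(* A neighbourhood of [M] contains a box of neighbourhoods of its finitely many entries, and a
   filter is closed under finite intersections. *)
move=> fM A [P PM PA]; apply: (@filterS _ _ _ _ _ (fun x xP => PA (f x) xP)).
by apply: filter_forall => i; apply: filter_forall => j; apply/fM/PM.
Qed.

Lemma cvg_real_complex (R : realType) (u : nat -> R) (l : R) :
  u @ \oo --> l -> (fun k => (u k)%:C : R[i]^o) @ \oo --> (l%:C : R[i]^o).
Proof.
move=> /cvgrPdist_lt ul; apply/cvgrPdist_lt => -[x y].
(* A positive element of [R[i]] has zero imaginary part, so the complex tolerance is a real one. *)
rewrite ltcE /= => /andP[/eqP -> x0].
have := ul x x0; apply: filterS => k.
by rewrite -rmorphB /= normc_def /= expr0n addr0 sqrtr_sqr ltcR.
Qed.

Section Expi.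
Variable R : realType.
Implicit Types x y : R.

Lemma expiD x y : expi (x + y) = expi x * expi y :> R[i].
Proof. by rewrite /expi cosD sinD [X in _ +i* X]addrC. Qed.

Lemma conj_expi x : (expi x)^* = expi (- x).
Proof. by rewrite /expi cosN sinN. Qed.

(** Even powers of ['i] produce the cosine series and odd powers the sine series, each convergent
    over the reals. *)
Lemma cvg_expi x :
  series (fun k => k`!%:R^-1 * ('i%C * x%:C) ^+ k) @ \oo --> (expi x : R[i]^o).
Proof.
have -> : (fun k => k`!%:R^-1 * ('i%C * x%:C) ^+ k) =
    (fun k => (cos_coeff x k)%:C + 'i%C * (sin_coeff x k)%:C).
  apply/funext => k; rewrite /cos_coeff /sin_coeff /= exprMn.
  (* The exponent [k.-1./2] is the one in [sin_coeff]; for odd [k] it equals [k./2]. *)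
  have -> : 'i%C ^+ k = ((~~ odd k)%:R * (-1) ^+ k./2)%:C
       + 'i%C * ((odd k)%:R * (-1) ^+ k.-1./2)%:C :> R[i].
    rewrite -{1}(odd_double_half k) exprD -mul2n exprM sqr_i.
    case: (boolP (odd k)) => k_odd /=.
      have -> : k.-1./2 = k./2.
        by rewrite -[in LHS](odd_double_half k) k_odd /= doubleK.
      by rewrite mul0r add0r expr1 mul1r rmorphXn rmorphN1.
    by rewrite expr0 !mul1r mul0r mulr0 addr0 rmorphXn rmorphN1.
  rewrite !rmorphM /= !fmorphV /= !rmorph_nat !rmorphXn /=; ring.
have -> : series (fun k => (cos_coeff x k)%:C + 'i%C * (sin_coeff x k)%:C) =
    (fun k => (series (cos_coeff x) k)%:C + 'i%C * (series (sin_coeff x) k)%:C).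
  apply/funext => k; rewrite /series /= !rmorph_sum /= mulr_sumr -big_split.
  by [].
rewrite [expi x]complexE /=.
have cosx : (fun k => (series (cos_coeff x) k)%:C : R[i]^o) @ \oo -->
    ((cos x)%:C : R[i]^o).
  by apply: cvg_real_complex; rewrite unlock; apply: is_cvg_series_cos_coeff.
have sinx : (fun k => (series (sin_coeff x) k)%:C : R[i]^o) @ \oo -->
    ((sin x)%:C : R[i]^o).
  by apply: cvg_real_complex; rewrite unlock; apply: is_cvg_series_sin_coeff.
have isinx := @cvgMl_tmp R[i] _ _ _ _ 'i%C _ sinx.
exact: (cvgD cosx (isinx _)).
Qed.

End Expi.


(** Partial sums of the exponential series stay diagonal in the basis, with scalar partial sums as
    eigenvalues, and converge entry by entry. *)
Lemma expmx_diag_in_basis (R : realType) (n : nat) (e : 'I_n -> 'cV[R[i]]_n)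
    (x : 'I_n -> R) :
  orthonormal_basis e ->
  expmx (diag_in_basis e (fun i => 'i%C * (x i)%:C)) =
  diag_in_basis e (fun i => expi (x i)).
Proof.
move=> e_basis; rewrite /expmx; apply: (@cvg_lim 'M[R[i]^o]_n).
  exact: norm_hausdorff.
have -> : series (fun k =>
      k`!%:R^-1 *: diag_in_basis e (fun i => 'i%C * (x i)%:C) ^+ k) =
    (fun N => diag_in_basis e
      (fun i => series (fun k => k`!%:R^-1 * ('i%C * (x i)%:C) ^+ k) N)).
  apply/funext => N; rewrite /series /= -diag_in_basis_sum.
  by apply: eq_bigr => k _; rewrite diag_in_basisX // diag_in_basisZ.
apply: (@cvg_mx R[i]) => k l; rewrite diag_in_basisE.
under eq_fun do rewrite diag_in_basisE.
apply: cvg_big => [|i _]; first exact: add_continuous.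
  apply: (@cvgMr_tmp R[i]).
exact: cvg_expi.
Qed.

(** * Linearity of complex and matrix integrals *)

Section ComplexIntegrals.
Variable R : realType.
Local Notation C := R[i].
Local Notation mu := (@lebesgue_measure R).
Variable D : set R.
Hypothesis D_measurable : measurable (D : set (measurableTypeR R)).

Lemma cintegrable0 : cintegrable D (fun=> 0 : C).
Proof. by split; apply: integrable0. Qed.

Lemma cintegral0 : cintegral D (fun=> 0 : C) = 0.
Proof. by rewrite /cintegral /= /Rintegral integral0. Qed.

Lemma cintegrableD (f g : R -> C) :
  cintegrable D f -> cintegrable D g -> cintegrable D (fun x => f x + g x).
Proof.
move=> [fR fI] [gR gI]; split.
  apply: (eq_integrable D_measurable _ _ _
    (integrableD D_measurable fR gR)) => x _.
  by rewrite /= raddfD.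
apply: (eq_integrable D_measurable _ _ _
    (integrableD D_measurable fI gI)) => x _.
by rewrite /= raddfD.
Qed.

Lemma cintegralD (f g : R -> C) : cintegrable D f -> cintegrable D g ->
  cintegral D (fun x => f x + g x) = cintegral D f + cintegral D g.
Proof.
move=> [fR fI] [gR gI]; rewrite /cintegral.
under eq_Rintegral do rewrite raddfD.
under [X in _ +i* X = _]eq_Rintegral do rewrite raddfD.
by rewrite !RintegralD.
Qed.

Lemma ReM (x y : C) :
  complex.Re (x * y) = complex.Re x * complex.Re y - complex.Im x * complex.Im y.
Proof. by case: x y => [a b] [c d]. Qed.

Lemma ImM (x y : C) :
  complex.Im (x * y) = complex.Re x * complex.Im y + complex.Im x * complex.Re y.
Proof. by case: x y => [a b] [c d]. Qed.

Let integrableMl_cst (a : R) (f : R -> R) :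
  mu.-integrable D (EFin \o f) -> mu.-integrable D (EFin \o (fun x => a * f x)).
Proof.
by move=> fi; apply: (eq_integrable D_measurable _ _ _
    (integrableZl D_measurable a fi)) => x _.
Qed.

Lemma cintegrableZ (z : C) (f : R -> C) :
  cintegrable D f -> cintegrable D (fun x => z * f x).
Proof.
move=> [fR fI]; split.
  apply: (eq_integrable D_measurable _ _ _
    (integrableB D_measurable
      (integrableMl_cst (complex.Re z) fR)
      (integrableMl_cst (complex.Im z) fI))) => x _.
  by rewrite /= ReM.
apply: (eq_integrable D_measurable _ _ _
    (integrableD D_measurable
      (integrableMl_cst (complex.Re z) fI)
      (integrableMl_cst (complex.Im z) fR))) => x _.
by rewrite /= ImM.
Qed.

Lemma cintegralZ (z : C) (f : R -> C) : cintegrable D f ->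
  cintegral D (fun x => z * f x) = z * cintegral D f.
Proof.
move=> [fR fI]; rewrite /cintegral.
under eq_Rintegral do rewrite ReM.
under [X in _ +i* X = _]eq_Rintegral do rewrite ImM.
rewrite RintegralB ?RintegralD //; try exact: integrableMl_cst.
by rewrite !RintegralZl //; case: z.
Qed.

(** Finite combinations with constant coefficients cover every integrand met later: matrix entries,
    matrix elements and eigenvalues of the noise. *)
Lemma cintegrable_lin (I : Type) (s : seq I) (z : I -> C) (f : I -> R -> C) :
  (forall i, cintegrable D (f i)) ->
  cintegrable D (fun x => \sum_(i <- s) z i * f i x).
Proof.
move=> f_int; elim: s => [|i s IHs].
  by under eq_fun do rewrite big_nil; apply: cintegrable0.
under eq_fun do rewrite big_cons.
by apply: cintegrableD => //; apply: cintegrableZ.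
Qed.

Lemma cintegral_lin (I : Type) (s : seq I) (z : I -> C) (f : I -> R -> C) :
  (forall i, cintegrable D (f i)) ->
  cintegral D (fun x => \sum_(i <- s) z i * f i x) =
  \sum_(i <- s) z i * cintegral D (f i).
Proof.
move=> f_int; elim: s => [|i s IHs].
  by under eq_fun do rewrite big_nil; rewrite big_nil cintegral0.
under eq_fun do rewrite big_cons.
rewrite cintegralD ?cintegralZ // ?IHs ?big_cons //; first exact: cintegrableZ.
exact: cintegrable_lin.
Qed.

Section Matrices.
Variables (n : nat) (e : 'I_n -> 'cV[C]_n).

Lemma mxintegrable_diag_in_basis (x : R -> 'I_n -> C) :
  (forall i, cintegrable D (x^~ i)) ->
  mxintegrable D (fun s => diag_in_basis e (x s)).
Proof.
move=> x_int k l; under eq_fun do rewrite diag_in_basisE.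
under eq_fun => s do under eq_bigr => i _ do rewrite mulrC.
exact: cintegrable_lin.
Qed.

Lemma mxintegral_diag_in_basis (x : R -> 'I_n -> C) :
  (forall i, cintegrable D (x^~ i)) ->
  mxintegral D (fun s => diag_in_basis e (x s)) =
  diag_in_basis e (fun i => cintegral D (x^~ i)).
Proof.
move=> x_int; apply/matrixP => k l; rewrite mxE diag_in_basisE.
under eq_fun do rewrite diag_in_basisE.
under eq_fun => s do under eq_bigr => i _ do rewrite mulrC.
by rewrite cintegral_lin //; apply: eq_bigr => i _; rewrite mulrC.
Qed.

(** A single sum over pairs of indices exhibits the matrix element as a linear combination of
    entries, the form needed to integrate it. *)
Lemma mxeltE (u v : 'cV[C]_n) (M : 'M[C]_n) :
  mxelt u M v = \sum_q ((u q.1 0)^* * v q.2 0) * M q.1 q.2.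
Proof.
rewrite /mxelt mxE -(pair_bigA _ (fun k l => ((u k 0)^* * v l 0) * M k l)).
rewrite exchange_big /=.
apply: eq_bigr => l _; rewrite mxE mulr_suml; apply: eq_bigr => k _.
by rewrite !mxE mulrAC.
Qed.

Lemma mxeltZ (u v : 'cV[C]_n) (a : C) (M : 'M[C]_n) :
  mxelt u (a *: M) v = a * mxelt u M v.
Proof. by rewrite /mxelt -scalemxAr -scalemxAl mxE. Qed.

Lemma mxelt_mxintegral (u v : 'cV[C]_n) (F : R -> 'M[C]_n) : mxintegrable D F ->
  mxelt u (mxintegral D F) v = cintegral D (fun x => mxelt u (F x) v).
Proof.
move=> F_int; under eq_fun do rewrite mxeltE.
rewrite mxeltE cintegral_lin => [|q]; last exact: F_int.
by apply: eq_bigr => q _; rewrite mxE.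
Qed.

(** The converse of [mxeltE]: it carries integrability from matrix elements back to entries. *)
Lemma mx_expansion (M : 'M[C]_n) (k l : 'I_n) : orthonormal_basis e ->
  M k l = \sum_q (e q.1 k 0 * (e q.2 l 0)^*) * mxelt (e q.1) M (e q.2).
Proof.
move=> e_basis.
transitivity
  ((basis_mx e *m (basis_mx e ^t* *m M *m basis_mx e) *m basis_mx e ^t*) k l).
  rewrite !mulmxA basis_mx_unitaryC // mul1mx -mulmxA.
  by rewrite basis_mx_unitaryC // mulmx1.
rewrite mxelt_basis_mx mxE.
rewrite -(pair_bigA _
  (fun i j => (e i k 0 * (e j l 0)^*) * mxelt (e i) M (e j))) exchange_big /=.
apply: eq_bigr => j _; rewrite mxE mulr_suml; apply: eq_bigr => i _.
by rewrite !mxE mulrAC.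
Qed.

Lemma mxintegrable_mxelt (F : R -> 'M[C]_n) : orthonormal_basis e ->
  (forall i j, cintegrable D (fun x => mxelt (e i) (F x) (e j))) ->
  mxintegrable D F.
Proof.
move=> e_basis F_int k l; under eq_fun do rewrite (mx_expansion _ _ _ e_basis).
by apply: cintegrable_lin => q; apply: F_int.
Qed.

End Matrices.
End ComplexIntegrals.

(** The density is integrable, having mass 1, and it is multiplied by a cosine or sine, continuous
    and bounded by 1. *)
Lemma cintegrable_fourier (R : realType) (p : R -> R) (g : R) :
  probability_density p ->
  cintegrable setT (fun a => (p a)%:C * expi (- (a * g))).
Proof.
move=> [p_meas p_ge0 p_int1].
have p_int : (@lebesgue_measure R).-integrable setT (EFin \o p).
  apply/integrableP; split; first exact/measurable_EFinP.
  under eq_integral do rewrite /= ger0_norm //.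
  by rewrite p_int1 ltry.
have int_bounded (h : R -> R) : continuous h -> (forall x, `|h x| <= 1) ->
    (@lebesgue_measure R).-integrable setT (fun a => (p a * h (- (a * g)))%:E).
  move=> h_cont h_le1; apply: (integrableMl measurableT p_int).
    apply: continuous_measurable_fun => x.
    apply: continuous_comp; last exact: h_cont.
    by apply: cvgN; apply: cvgMr_tmp.
  by exists 1; split=> // M M1 x _; apply: le_trans (h_le1 _) (ltW M1).
split.
  apply: (eq_integrable measurableT _ _ _
    (int_bounded cos (@continuous_cos R) (@cos_max R))) => a _.
  by rewrite ReM /= mul0r subr0.
apply: (eq_integrable measurableT _ _ _
    (int_bounded sin (@continuous_sin R) (@sin_max R))) => a _.
by rewrite ImM /= mul0r addr0.
Qed.

(** * The noise model and its averaged evolution *)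

Theorem mainTheorem2 (R : realType) (n m : nat) (n_ge2 : (2 <= n)%N)
    (A : seq 'M[R[i]]_(2 ^ n))
    (A_uniq : uniq A)
    (A_size : size A = (2 ^ n - 1)%N)
    (A_pauli : forall O, O \in A -> pauli_operator O)
    (A_nonid : 1%:M \notin A)
    (A_comm : forall O O', O \in A -> O' \in A -> O *m O' = O' *m O)
    (e : 'I_(2 ^ n) -> 'cV[R[i]]_(2 ^ n))
    (e_basis : orthonormal_basis e)
    (e_eigen : forall O i, O \in A -> eigenvector O (e i))
    (H : 'M[R[i]]_(2 ^ n * m))
    (H_herm : H \is hermsymmx)
    (H_comm : forall O, O \in A ->
       H *m (O *t (1%:M : 'M[R[i]]_m)) = (O *t (1%:M : 'M[R[i]]_m)) *m H)
    (rhoB : 'M[R[i]]_m)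
    (rhoB_density : density_operator rhoB)
    (r : 'I_(2 ^ n) -> 'I_(2 ^ n) -> R -> R[i])
    (r_def : forall rho0, density_operator rho0 ->
       forall i j t, 0 <= t ->
         mxelt (e i) (reduced_state H rhoB rho0 t) (e j)
         = r i j t * mxelt (e i) rho0 (e j))
    (p : R -> R) (p_density : probability_density p)
    (d : 'I_(2 ^ n) -> R -> R)
    (d_int : forall i, locally_integrable_nonneg (d i))
    (theta : 'I_(2 ^ n) -> R -> R)
    (theta_def : forall i t, 0 <= t ->
       theta i t = \int[lebesgue_measure]_(s in `[0, t]) d i s)
    (r_fourier : forall i j t, 0 <= t ->
       r i j t = fourier p (theta i t - theta j t)) :
  exists (D : R -> 'M[R[i]]_(2 ^ n)) (Hnoise : R -> R -> 'M[R[i]]_(2 ^ n)),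
    [/\ forall t, exists c : 'M[R[i]]_(2 ^ n) -> R,
          D t = \sum_(O <- A) (c O)%:C *: O,
        forall a t, Hnoise a t = a%:C *: D t /\ Hnoise a t \is hermsymmx,
        forall a t, 0 <= t -> mxintegrable `[0, t] (Hnoise a)
      & forall rho0, density_operator rho0 -> forall t, 0 <= t ->
          let integrand := fun a : R =>
            (p a)%:C *: (propagator (Hnoise a) t *m rho0
                         *m (propagator (Hnoise a) t) ^t*) in
          mxintegrable setT integrand /\
          reduced_state H rhoB rho0 t = mxintegral setT integrand].
Proof.
have [lam [A_diag lam_orth]] :=
  pauli_spectrum A_uniq A_size A_pauli A_nonid e_basis e_eigen.
have N0 : (2 ^ n)%:R != 0 :> R by rewrite pnatr_eq0 expn_eq0.
(* The coefficient [2^-n Tr(O X)] of the Pauli operator [O] in [X = \sum_i d_i(s) |e_i><e_i|]. *)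
pose c s (O : 'M[R[i]]_(2 ^ n)) : R := (2 ^ n)%:R^-1 * \sum_i lam O i * d i s.
(* With these weights [\sum_i w i j * d i s] is [d j s] minus the mean of all the [d i s]. *)
pose w (i j : 'I_(2 ^ n)) : R := (i == j)%:R - (2 ^ n)%:R^-1.
pose D s := \sum_(O <- A) (c s O)%:C *: O.
have D_diag s : D s = diag_in_basis e (fun j => (\sum_i w i j * d i s)%:C).
  rewrite /D.
  under eq_big_seq => O OA do rewrite [X in _ *: X]A_diag // diag_in_basisZ.
  rewrite diag_in_basis_sum; congr diag_in_basis; apply/funext => j.
  under eq_bigr do rewrite -rmorphM.
  rewrite -rmorph_sum; congr _%:C.
  under eq_bigr => O _ do rewrite /c -mulrA mulr_suml mulr_sumr.
  (* Summing over [O] first lets column orthogonality produce the weight [w i j]. *)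
  rewrite exchange_big; apply: eq_bigr => i _ /=.
  under eq_bigr => O _ do rewrite (mulrAC _ (d i s)) mulrA.
  by rewrite -mulr_suml -mulr_sumr lam_orth /w mulrBr mulKf // mulr1.
pose Hnoise a s : 'M[R[i]]_(2 ^ n) := a%:C *: D s.
(* The eigenvalues are kept as constant-coefficient combinations of the [d i], ready for integration
   in time. *)
have Hnoise_diag a u : Hnoise a u =
    diag_in_basis e (fun j => \sum_i (a * w i j)%:C * (d i u)%:C).
  rewrite /Hnoise D_diag diag_in_basisZ; congr diag_in_basis; apply/funext => j.
  rewrite rmorph_sum mulr_sumr; apply: eq_bigr => i _.
  by rewrite rmorphM mulrA -rmorphM.
have dC_int t i : 0 <= t -> cintegrable `[0, t] (fun s => (d i s)%:C).
  by move=> t0; split; [apply: d_int | apply: integrable0].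
have itv_meas (t : R) : measurable (`[0, t]%classic : set (measurableTypeR R)).
  exact: measurable_itv.
have dC_lin_int a t j : 0 <= t ->
    cintegrable `[0, t] (fun s => \sum_i (a * w i j)%:C * (d i s)%:C).
  by move=> t0; apply: cintegrable_lin => // i; apply: dC_int.
(* For [t >= 0] this is the time integral of eigenvalue [j] of [D]: [theta j t] minus the mean of
   the [theta i t], and the mean cancels in differences. *)
pose phase t j := \sum_i w i j * theta i t.
have phaseB t i j : phase t i - phase t j = theta i t - theta j t.
  have phaseE k : phase t k = theta k t - (2 ^ n)%:R^-1 * \sum_i theta i t.
    rewrite /phase; under eq_bigr do rewrite mulrBl.
    rewrite sumrB -mulr_sumr (bigD1 k) //= eqxx mul1r big1 ?addr0 //.
    by move=> l /negPf ->; rewrite mul0r.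
  by rewrite !phaseE opprB addrA subrK.
have propagator_diag a t : 0 <= t ->
    propagator (Hnoise a) t =
    diag_in_basis e (fun j => expi (- (a * phase t j))).
  move=> t0; rewrite /propagator.
  rewrite (funext (Hnoise_diag a)).
  rewrite mxintegral_diag_in_basis // => [|j]; last exact: dC_lin_int.
  rewrite diag_in_basisZ.
  rewrite -(expmx_diag_in_basis (fun j => - (a * phase t j)) e_basis).
  apply: (congr1 (@expmx R _)); apply: (congr1 (diag_in_basis e)).
  apply/funext => j; rewrite cintegral_lin // => [|i]; last exact: dC_int.
  rewrite rmorphN mulrN mulNr /=; apply: (congr1 (fun z => - ('i%C * z))).
  rewrite /phase mulr_sumr rmorph_sum; apply: eq_bigr => i _.
  rewrite mulrA [in RHS]rmorphM theta_def //; congr (_ * _).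
  by rewrite /cintegral /= /Rintegral integral0.
exists D, Hnoise; split.
- by move=> s; exists (c s).
- move=> a s; split=> //; apply/is_hermitianmxP.
  rewrite expr0 scale1r Hnoise_diag.
  rewrite diag_in_basis_adj; congr diag_in_basis; apply/funext => j.
  rewrite rmorph_sum; apply: eq_bigr => i _; rewrite -rmorphM.
  exact/esym/conjc_real.
- move=> a t t0; rewrite (funext (Hnoise_diag a)).
  by apply: mxintegrable_diag_in_basis => // j; apply: dC_lin_int.
move=> rho0 rho0_density t t0 integrand.
(* In the basis [e], conjugation by the propagator multiplies each element of [rho0] by a phase,
   leaving the Fourier integrand times a constant. *)
have integrandE i j : (fun a => mxelt (e i) (integrand a) (e j)) =
    (fun a => mxelt (e i) rho0 (e j)
       * ((p a)%:C * expi (- (a * (theta i t - theta j t))))).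
  apply/funext => a; rewrite /integrand propagator_diag // diag_in_basis_adj.
  rewrite mxeltZ mxelt_diag_in_basis //.
  have -> : - (a * (theta i t - theta j t)) = - (a * phase t i) + a * phase t j.
    by rewrite -phaseB mulrBr opprB addrC.
  by rewrite conj_expi opprK -expiD mulrA mulrC.
have integrand_int : mxintegrable setT integrand.
  apply: (mxintegrable_mxelt _ e_basis) => // i j; rewrite integrandE.
  exact: (cintegrableZ measurableT _ (cintegrable_fourier _ p_density)).
(* Both states are compared through their elements in the basis [e], where each side is [fourier p]
   at the phase difference times the element of [rho0]. *)
split=> //; apply: (mxelt_inj e_basis) => i j.
rewrite r_def // r_fourier // mxelt_mxintegral // integrandE.
by rewrite (cintegralZ measurableT _ (cintegrable_fourier _ p_density)) mulrC.
Qed.
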